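(* Let $R$ be an associative ring with unit and let $M$ be a left $R$-module which is projective in $\sigma[M]$ and semiprime, with finitely many minimal prime submodules $P_1,\dots,P_t$. Suppose every quotient $M/P_i$ $(1\leq i\leq t)$ has finite uniform dimension. Then $M$ is a Goldie module if and only if each $M/P_i$ $(1\leq i\leq t)$ is a Goldie module.
   Context: Modules are unitary left $R$-modules. $\sigma[M]$ is the smallest full subcategory of $R$-Mod containing all modules isomorphic to a submodule of an $M$-generated module (a quotient of a direct sum of copies of $M$). $M$ is projective in $\sigma[M]$ if every morphism $M\to N$ lifts along every epimorphism $L\to N$ in $\sigma[M]$. For submodules $K,L\leq M$, $K_ML=\sum\{f(K)\mid f\in Hom_R(M,L)\}$. A submodule $K\le M$ is fully invariant if $f(K)\le K$ for all $f\in End_R(M)$. A fully invariant submodule $P\leq M$ is prime in $M$ if for all fully invariant submodules $K,L\leq M$, $K_ML\leq P$ implies $K\leq P$ or $L\leq P$; a minimal prime submodule is a minimal element (under inclusion) among the prime submodules in $M$. $M$ is a semiprime module if for every fully invariant submodule $K\leq M$, $K_MK=0$ implies $K=0$. For any module $X$, a left annihilator in $X$ is a submodule of the form $\bigcap\{Ker(f)\mid f\in Y\}$ for some $Y\subseteq End_R(X)$. $X$ is a Goldie module if it satisfies the ascending chain condition on left annihilators in $X$ and has finite uniform dimension. *)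

(* Defs.v *)
From HB Require Import structures.
From mathcomp Require Import all_boot all_order all_algebra.
From mathcomp Require Import boolp classical_sets functions cardinality.

Set Implicit Arguments.
Unset Strict Implicit.
Unset Printing Implicit Defensive.

Import GRing.Theory.
Local Open Scope ring_scope.
Local Open Scope quotient_scope.

(* Submodules of M are elements of [submodClosed M]: boolean predicates, which
   by [asbool] lose no generality.  They are compared by =i and {subset _ <= _},
   since Leibniz equality also involves the closure proofs. *)

Section QuotientModule.
Variables (R : pzRingType) (M : lmodType R) (P : submodClosed M).

Fact submod_zmod_closed : zmod_closed (P : {pred M}).
Proof.
split=> [|x y xP yP]; first exact: rpred0.
by rewrite -scaleN1r rpredD ?rpredZ.
Qed.

Definition submod_zmodClosed : zmodClosed M :=
  HB.pack (P : {pred M})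
    (GRing.isZmodClosed.Build M (P : {pred M}) submod_zmod_closed).

Definition quotmod : Type := Quotient.quot submod_zmodClosed.

HB.instance Definition _ := Choice.on quotmod.
HB.instance Definition _ := GRing.Zmodule.on quotmod.
HB.instance Definition _ := EqQuotient.on quotmod.

Definition quotmod_scale (a : R) (q : quotmod) : quotmod :=
  \pi_quotmod (a *: repr q).

Fact quotmod_eqE x y : (\pi_quotmod x == \pi_quotmod y) = (x - y \in P).
Proof. by rewrite -(Quotient.idealrBE submod_zmodClosed). Qed.

Fact quotmod_piD x y : \pi_quotmod (x + y) = \pi_quotmod x + \pi_quotmod y.
Proof.
exact: (raddfD (\pi_(Quotient.quot submod_zmodClosed)
                : {additive M -> Quotient.quot submod_zmodClosed})).
Qed.

Fact quotmod_piZ a x : \pi_quotmod (a *: x) = quotmod_scale a (\pi_quotmod x).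
Proof.
apply/eqP; rewrite quotmod_eqE -scalerBr rpredZ // -quotmod_eqE.
by rewrite reprK.
Qed.

Fact quotmod_scaleA a b q :
  quotmod_scale a (quotmod_scale b q) = quotmod_scale (a * b) q.
Proof. by rewrite -[q]reprK -!quotmod_piZ scalerA reprK. Qed.

Fact quotmod_scale1 : left_id 1 quotmod_scale.
Proof. by move=> q; rewrite -[q]reprK -quotmod_piZ scale1r. Qed.

Fact quotmod_scaleDr : right_distributive quotmod_scale +%R.
Proof.
move=> a p q; rewrite -[p]reprK -[q]reprK.
by rewrite -quotmod_piD -!quotmod_piZ scalerDr quotmod_piD.
Qed.

Fact quotmod_scaleDl q : {morph quotmod_scale^~ q : a b / a + b}.
Proof.
by move=> a b; rewrite -[q]reprK -!quotmod_piZ scalerDl quotmod_piD.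
Qed.

HB.instance Definition _ := GRing.Zmodule_isLmodule.Build R quotmod
  quotmod_scaleA quotmod_scale1 quotmod_scaleDr quotmod_scaleDl.

Definition quotmod_pi (x : M) : quotmod := \pi_quotmod x.

Fact quotmod_pi_is_linear : linear quotmod_pi.
Proof.
by move=> a x y; rewrite /quotmod_pi quotmod_piD quotmod_piZ.
Qed.

HB.instance Definition _ := GRing.isLinear.Build R M quotmod *:%R quotmod_pi
  quotmod_pi_is_linear.

Fact quotmod_pi_surj (q : quotmod) : exists x, quotmod_pi x = q.
Proof. by exists (repr q); rewrite /quotmod_pi reprK. Qed.

Fact quotmod_pi_eq0 x : (quotmod_pi x == 0) = (x \in P).
Proof. by rewrite -(linear0 quotmod_pi) quotmod_eqE subr0. Qed.

End QuotientModule.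

Section DirectSum.
Variables (I : Type) (R : pzRingType) (M : lmodType R).

Definition finsupp_pred : {pred I -> M} :=
  fun f => `[< finite_set [set i | f i <> 0]%classic >].

Fact finsupp_submod_closed : subsemimod_closed finsupp_pred.
Proof.
split; first split.
- apply/asboolP; apply: (@sub_finite_set _ _ set0) => //.
- move=> f g /asboolP ff /asboolP fg; apply/asboolP.
  apply: (@sub_finite_set _ _
    ([set i | f i <> 0] `|` [set i | g i <> 0])%classic); last first.
    by rewrite finite_setU.
  move=> i /= fgi; have [fi0|] := pselect (f i = 0); last by left.
  by right=> gi0; apply: fgi; rewrite -[LHS]/(f i + g i) fi0 gi0 addr0.
- move=> a f /asboolP ff; apply/asboolP; apply: sub_finite_set ff => i /= afi.
  by move=> fi0; apply: afi; rewrite -[LHS]/(a *: f i) fi0 scaler0.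
Qed.

HB.instance Definition _ := GRing.isSubmodClosed.Build R (I -> M) finsupp_pred
  finsupp_submod_closed.

Record dsum := DSum { dsum_fun :> I -> M; _ : dsum_fun \in finsupp_pred }.

HB.instance Definition _ := [isSub for dsum_fun].
HB.instance Definition _ := [Choice of dsum by <:].
HB.instance Definition _ := [SubChoice_isSubLmodule of dsum by <:].

End DirectSum.

Definition generated_by (R : pzRingType) (M N : lmodType R) : Prop :=
  exists (I : Type) (g : {linear dsum I M -> N}), forall y, exists x, g x = y.

(* "isomorphic to a submodule of N" is "has an injective linear map to N" *)
Definition in_sigma (R : pzRingType) (M X : lmodType R) : Prop :=
  exists N : lmodType R, generated_by M N /\
    exists f : {linear X -> N}, injective f.

(* Epimorphisms of sigma[M] are the surjective linear maps, as sigma[M] is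
   closed under quotients. *)
Definition projective_in_sigma (R : pzRingType) (M : lmodType R) : Prop :=
  forall L N : lmodType R, in_sigma M L -> in_sigma M N ->
  forall (g : {linear L -> N}), (forall y, exists x, g x = y) ->
  forall f : {linear M -> N}, exists h : {linear M -> L}, forall x, g (h x) = f x.

Section Prime.
Variables (R : pzRingType) (M : lmodType R).
Implicit Types K L P Q : submodClosed M.

(* K_M L; a morphism M -> L is an endomorphism of M with values in L. *)
Definition mprod K L : {pred M} := fun x =>
  `[< exists (n : nat) (f : 'I_n -> {linear M -> M}) (k : 'I_n -> M),
        [/\ forall i y, f i y \in L, forall i, k i \in K
          & x = \sum_(i < n) f i (k i)] >].

Definition fully_invariant K : Prop :=
  forall (f : {linear M -> M}) x, x \in K -> f x \in K.

(* P is not required to be proper. *)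
Definition prime_submod P : Prop :=
  fully_invariant P /\
  forall K L, fully_invariant K -> fully_invariant L ->
    {subset mprod K L <= P} -> {subset K <= P} \/ {subset L <= P}.

Definition minimal_prime P : Prop :=
  prime_submod P /\
  forall Q, prime_submod Q -> {subset Q <= P} -> Q =i P.

Definition semiprime_module : Prop :=
  forall K, fully_invariant K ->
    (forall x, x \in mprod K K -> x = 0) -> forall x, x \in K -> x = 0.

End Prime.

Section Goldie.
Variables (R : pzRingType) (X : lmodType R).

Definition lannihilator (Y : set {linear X -> X}) : set X :=
  [set x | forall f, Y f -> f x = 0]%classic.

Definition acc_lannihilators : Prop :=
  forall Y : nat -> set {linear X -> X},
    (forall n, (lannihilator (Y n) `<=` lannihilator (Y n.+1))%classic) ->
    exists m, forall n, (m <= n)%N -> lannihilator (Y n) = lannihilator (Y m).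

Definition independent_submods (N : nat -> submodClosed X) : Prop :=
  forall (n : nat) (x : 'I_n -> X), (forall i, x i \in N i) ->
    \sum_(i < n) x i = 0 -> forall i, x i = 0.

(* X contains no infinite direct sum of nonzero submodules *)
Definition finite_uniform_dim : Prop :=
  ~ exists N : nat -> submodClosed X,
      (forall k, exists2 x, x \in N k & x != 0) /\ independent_submods N.

Definition goldie_module : Prop := acc_lannihilators /\ finite_uniform_dim.

End Goldie.

(* Main.v *)
(* Projectivity of M in sigma[M] is used twice: endomorphisms of M/P lift to M,
   and a morphism M -> K + L is a sum of morphisms M -> K and M -> L.  The latter
   gives (P + K)_M (P + L) <= P whenever K_M L <= P and P is fully invariant, so
   that an "m-sequence" argument as for rings shows that the primes of a
   semiprime M, hence also its minimal primes P_i, have zero intersection.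
   Thus M embeds into the product of the M/P_i, and finite uniform dimension and
   the chain condition pass from all the M/P_i to M.
   Conversely P_i is itself a left annihilator in M, namely that of the
   endomorphisms with values in Q_i, the intersection of the P_j <> P_i: these
   kill P_i because P_i and Q_i meet in zero, and if they kill K then
   K_M Q_i = 0 <= P_i, whence K <= P_i. *)
Require Import Defs.
From HB Require Import structures.
From mathcomp Require Import all_boot all_order all_algebra.
From mathcomp Require Import boolp classical_sets cardinality.

Set Implicit Arguments.
Unset Strict Implicit.
Unset Printing Implicit Defensive.

Import GRing.Theory.
Local Open Scope ring_scope.

(** * Submodules cut out by propositions, and operations on submodules *)

Section SubmoduleOfProp.
Variables (R : pzRingType) (M : lmodType R) (S : M -> Prop).
Hypotheses (S0 : S 0) (SD : forall x y, S x -> S y -> S (x + y))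
  (SZ : forall a x, S x -> S (a *: x)).

Fact submod_of_closed : subsemimod_closed [pred x | `[< S x >]].
Proof.
split; [split; first exact/asboolP|] => [x y|a x].
  by move=> /asboolP Sx /asboolP Sy; apply/asboolP/SD.
by move=> /asboolP Sx; apply/asboolP/SZ.
Qed.

Definition submod_of : submodClosed M :=
  HB.pack ([pred x | `[< S x >]] : {pred M})
    (GRing.isSubmodClosed.Build R M [pred x | `[< S x >]] submod_of_closed).

Lemma submod_ofP x : x \in submod_of <-> S x.
Proof. by split=> /asboolP. Qed.

End SubmoduleOfProp.

Section SubmoduleConstructions.
Variables (R : pzRingType) (M : lmodType R).
Implicit Types K L : submodClosed M.

Lemma submod_zero_subproof : exists K : submodClosed M,
  forall x, x \in K <-> x = 0.
Proof.
have S0 : (0 : M) = 0 by [].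
have SD (x y : M) : x = 0 -> y = 0 -> x + y = 0.
  by move=> -> ->; rewrite addr0.
have SZ (a : R) (x : M) : x = 0 -> a *: x = 0 by move=> ->; rewrite scaler0.
by exists (submod_of S0 SD SZ) => x; apply: submod_ofP.
Qed.

Lemma submod_sum_subproof K L : exists N : submodClosed M,
  forall x, x \in N <-> exists y z, [/\ y \in K, z \in L & x = y + z].
Proof.
pose S x := exists y z, [/\ y \in K, z \in L & x = y + z].
have S0 : S 0 by exists 0, 0; rewrite !rpred0 addr0.
have SD x y : S x -> S y -> S (x + y).
  move=> [x1 [x2 [Kx1 Lx2 ->]]] [y1 [y2 [Ky1 Ly2 ->]]].
  by exists (x1 + y1), (x2 + y2); rewrite !rpredD //; split=> //; apply: addrACA.
have SZ a x : S x -> S (a *: x).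
  move=> [x1 [x2 [Kx1 Lx2 ->]]].
  by exists (a *: x1), (a *: x2); rewrite !rpredZ // scalerDr.
by exists (submod_of S0 SD SZ) => x; apply: submod_ofP.
Qed.

Lemma submod_bigcap_subproof (F : submodClosed M -> Prop) :
  exists N : submodClosed M,
  forall x, x \in N <-> forall K, F K -> x \in K.
Proof.
pose S x := forall K, F K -> x \in K.
have S0 : S 0 by move=> K _; apply: rpred0.
have SD x y : S x -> S y -> S (x + y).
  by move=> Sx Sy K FK; rewrite rpredD ?Sx ?Sy.
have SZ a x : S x -> S (a *: x) by move=> Sx K FK; rewrite rpredZ ?Sx.
by exists (submod_of S0 SD SZ) => x; apply: submod_ofP.
Qed.

Lemma submod_chain_bigcup (F : submodClosed M -> Prop) K0 :
  F K0 ->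
  (forall K L, F K -> F L -> {subset K <= L} \/ {subset L <= K}) ->
  exists N : submodClosed M,
  forall x, x \in N <-> exists2 K, F K & x \in K.
Proof.
move=> FK0 Fchain; pose S x := exists2 K : submodClosed M, F K & x \in K.
have S0 : S 0 by exists K0; rewrite ?rpred0.
have SD x y : S x -> S y -> S (x + y).
  move=> [K FK Kx] [L FL Ly]; have [KL|LK] := Fchain K L FK FL.
    by exists L; rewrite // rpredD // KL.
  by exists K; rewrite // rpredD // LK.
have SZ a x : S x -> S (a *: x) by move=> [K FK Kx]; exists K; rewrite ?rpredZ.
by exists (submod_of S0 SD SZ) => x; apply: submod_ofP.
Qed.

(** Chosen from an opaque existence proof, so that only the membership equivalence can be used. *)
Definition submod_zero := projT1 (cid submod_zero_subproof).
Lemma submod_zeroP x : x \in submod_zero <-> x = 0.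
Proof. exact: (projT2 (cid submod_zero_subproof)). Qed.

Definition submod_sum K L := projT1 (cid (submod_sum_subproof K L)).
Lemma submod_sumP K L x :
  x \in submod_sum K L <-> exists y z, [/\ y \in K, z \in L & x = y + z].
Proof. exact: (projT2 (cid (submod_sum_subproof K L))). Qed.

Definition submod_bigcap F := projT1 (cid (submod_bigcap_subproof F)).
Lemma submod_bigcapP F x :
  x \in submod_bigcap F <-> forall K, F K -> x \in K.
Proof. exact: (projT2 (cid (submod_bigcap_subproof F))). Qed.

Lemma submod_sumSl K L : {subset K <= submod_sum K L}.
Proof. by move=> x Kx; apply/submod_sumP; exists x, 0; rewrite rpred0 addr0. Qed.

Lemma submod_sumSr K L : {subset L <= submod_sum K L}.
Proof. by move=> x Lx; apply/submod_sumP; exists 0, x; rewrite rpred0 add0r. Qed.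

End SubmoduleConstructions.

Section LinearImages.
Variables (R : pzRingType) (M N : lmodType R) (f : {linear M -> N}).

Lemma submod_image_subproof (K : submodClosed M) : exists L : submodClosed N,
  forall y, y \in L <-> exists2 x, x \in K & f x = y.
Proof.
pose S y := exists2 x, x \in K & f x = y.
have S0 : S 0 by exists 0; rewrite ?rpred0 ?linear0.
have SD x y : S x -> S y -> S (x + y).
  move=> [u Ku <-] [v Kv <-].
  by exists (u + v); rewrite ?rpredD // linearD.
have SZ a x : S x -> S (a *: x).
  by move=> [u Ku <-]; exists (a *: u); rewrite ?rpredZ // linearZ.
by exists (submod_of S0 SD SZ) => x; apply: submod_ofP.
Qed.

Definition submod_image K := projT1 (cid (submod_image_subproof K)).
Lemma submod_imageP K y :
  y \in submod_image K <-> exists2 x, x \in K & f x = y.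
Proof. exact: (projT2 (cid (submod_image_subproof K))). Qed.

End LinearImages.

(** A submodule as a module in its own right, since [in_sigma] and [projective_in_sigma] speak of
    modules. *)
Record subm (R : pzRingType) (M : lmodType R) (K : submodClosed M) :=
  Subm { subm_val :> M; _ : subm_val \in K }.

HB.instance Definition _ R M K := [isSub for @subm_val R M K].
HB.instance Definition _ R M K := [Choice of @subm R M K by <:].
HB.instance Definition _ R M K :=
  [SubChoice_isSubLmodule of @subm R M K by <:].

Section Corestriction.
Variables (R : pzRingType) (M N : lmodType R) (K : submodClosed N).
Variables (f : {linear M -> N}) (fK : forall x, f x \in K).

Definition corestr x : subm K := Subm (fK x).

Fact corestr_is_linear : linear corestr.
Proof. by move=> a x y; apply: val_inj; rewrite /= linearP. Qed.

HB.instance Definition _ := GRing.isLinear.Build R M (subm K) *:%R corestr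
  corestr_is_linear.

End Corestriction.

(** * Consequences of projectivity in $\sigma[M]$ *)

Section Sigma.
Variables (R : pzRingType) (M : lmodType R).

Section GeneratedByPair.
Variables (N : lmodType R) (h : {linear (M * M)%type -> N}).

Definition dsum_pair (x : dsum bool M) : N := h (x true, x false).

Fact dsum_pair_is_linear : linear dsum_pair.
Proof. by move=> a x y; rewrite /dsum_pair -linearP. Qed.

HB.instance Definition _ := GRing.isLinear.Build R (dsum bool M) N *:%R
  dsum_pair dsum_pair_is_linear.

(** Two copies of [M], indexed by [bool], suffice for every module to which projectivity is applied
    below. *)
Lemma generated_by_pair : (forall y, exists x, h x = y) -> generated_by M N.
Proof.
move=> hsurj; exists bool, dsum_pair => y; have [[u v] <-] := hsurj y.
have fin : (fun b : bool => if b then u else v) \in finsupp_pred (M := M).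
  exact/asboolP/finite_finset.
by exists (DSum fin).
Qed.

End GeneratedByPair.

Lemma in_sigma_quot (N : lmodType R) (h : {linear M -> N}) :
  (forall y, exists x, h x = y) -> in_sigma M N.
Proof.
move=> hsurj; exists N; split; last by exists (idfun : {linear N -> N}).
apply: (generated_by_pair (h := h \o (fst : {linear (M * M)%type -> M}))) => y.
by have [x <-] := hsurj y; exists (x, 0).
Qed.

Lemma in_sigma_sub_pair (K : submodClosed (M * M)%type) : in_sigma M (subm K).
Proof.
exists (M * M)%type; split.
  apply: (generated_by_pair (h := idfun)) => y; by exists y.
by exists (val : {linear subm K -> (M * M)%type}); apply: val_inj.
Qed.

Lemma in_sigma_sub (K : submodClosed M) : in_sigma M (subm K).
Proof.
exists M; split; last by exists (val : {linear subm K -> M}); apply: val_inj.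
apply: (generated_by_pair (h := fst)) => y; by exists (y, 0).
Qed.

Hypothesis projM : projective_in_sigma M.

(** Addition maps $K \times L$ onto $K + L$; the two components of a lift of [f] along it are the
    summands. *)
Lemma projective_split_sum (K L : submodClosed M) (f : {linear M -> M}) :
  (forall x, f x \in submod_sum K L) ->
  exists f1 f2 : {linear M -> M},
    [/\ forall x, f1 x \in K, forall x, f2 x \in L
      & forall x, f x = f1 x + f2 x].
Proof.
move=> fKL; pose S (u : (M * M)%type) := u.1 \in K /\ u.2 \in L.
have S0 : S 0 by rewrite /S /= !rpred0.
have SD x y : S x -> S y -> S (x + y).
  by move=> [? ?] [? ?]; rewrite /S /= !rpredD.
have SZ a x : S x -> S (a *: x) by move=> [? ?]; rewrite /S /= !rpredZ.
pose KxL := submod_of S0 SD SZ.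
have KxLP (u : subm KxL) : S (val u) 
  by case: u => u uS; apply: (submod_ofP S0 SD SZ u).1 uS.
pose add2 :=
  (fst : {linear (M * M)%type -> M}) \+ (snd : {linear (M * M)%type -> M}).
pose add : {linear subm KxL -> M} :=
  add2 \o (val : {linear subm KxL -> (M * M)%type}).
have addKL u : add u \in submod_sum K L.
  by apply/submod_sumP; have [Ku Lu] := KxLP u; exists (val u).1, (val u).2.
have gsurj (y : subm (submod_sum K L)) : exists u, corestr addKL u = y.
  case: y => y KLy; have [a [b [Ka Lb yE]]] := (submod_sumP _ _ _).1 KLy.
  have Sab : (a, b) \in KxL by apply: (submod_ofP S0 SD SZ _).2.
  by exists (Subm Sab); apply: val_inj; rewrite /= yE.
have [h hE] :=
  projM (in_sigma_sub_pair KxL) (in_sigma_sub _) gsurj (corestr fKL).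
pose vh := (val : {linear subm KxL -> (M * M)%type}) \o h.
exists ((fst : {linear (M * M)%type -> M}) \o vh),
  ((snd : {linear (M * M)%type -> M}) \o vh).
split=> x /=; [by have [] := KxLP (h x) | by have [] := KxLP (h x) |].
by have /(congr1 val) := hE x.
Qed.

Lemma projective_lift_quot (P : submodClosed M)
    (g : {linear quotmod P -> quotmod P}) :
  exists f : {linear M -> M}, forall x, quotmod_pi P (f x) = g (quotmod_pi P x).
Proof.
have pi_surj := @quotmod_pi_surj _ _ P.
have sM : in_sigma M M by apply: (in_sigma_quot (h := idfun)) => y; exists y.
exact: (projM sM (in_sigma_quot pi_surj) pi_surj (g \o quotmod_pi P)).
Qed.

End Sigma.

(** * Fully invariant submodules, and the intersection of the minimal primes *)

Section FullyInvariant.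
Variables (R : pzRingType) (M : lmodType R).
Implicit Types K L P Q : submodClosed M.

Lemma mprod_subP K L P : {subset mprod K L <= P} <->
  forall (f : {linear M -> M}) k, (forall y, f y \in L) -> k \in K -> f k \in P.
Proof.
split=> [KLP f k fL Kk | KLP x /asboolP[n [f [k [fL Kk ->]]]]].
  apply/KLP/asboolP; exists 1%N, (fun=> f), (fun=> k).
  by split=> //; rewrite big_ord1.
by apply: rpred_sum => i _; apply: KLP.
Qed.

Lemma fully_invariant_sum K L :
  fully_invariant K -> fully_invariant L -> fully_invariant (submod_sum K L).
Proof.
move=> fiK fiL f x /submod_sumP[y [z [Ky Lz ->]]].
by apply/submod_sumP; exists (f y), (f z); rewrite linearD fiK ?fiL.
Qed.

Lemma fully_invariant_bigcap (F : submodClosed M -> Prop) :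
  (forall K, F K -> fully_invariant K) -> fully_invariant (submod_bigcap F).
Proof.
move=> fiF f x /submod_bigcapP xF; apply/submod_bigcapP => K FK.
by apply: fiF => //; apply: xF.
Qed.

(** The analogue of the two-sided ideal generated by one element. *)
Definition fi_closure x : submodClosed M :=
  submod_bigcap (fun K => fully_invariant K /\ x \in K).

Lemma fi_closure_mem x : x \in fi_closure x.
Proof. by apply/submod_bigcapP => K []. Qed.

Lemma fi_closure_fully_invariant x : fully_invariant (fi_closure x).
Proof. by apply: fully_invariant_bigcap => K []. Qed.

Lemma fi_closure_sub x K :
  fully_invariant K -> x \in K -> {subset fi_closure x <= K}.
Proof. by move=> fiK Kx y /submod_bigcapP; apply. Qed.

Hypothesis projM : projective_in_sigma M.

Lemma mprod_sum_sub P K L : fully_invariant P ->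
  {subset mprod K L <= P} ->
  {subset mprod (submod_sum P K) (submod_sum P L) <= P}.
Proof.
move=> fiP /mprod_subP KLP; apply/mprod_subP => f x fPL.
move=> /submod_sumP[p [k [Pp Kk ->]]]; rewrite linearD rpredD //; first exact: fiP.
(* The component [f1] has values in [P] anyway, and [f2 k] belongs to $K_M L$. *)
have [f1 [f2 [f1P f2L ->]]] := projective_split_sum projM fPL.
by rewrite rpredD // KLP.
Qed.

(* x is the module analogue of an m-sequence: a maximal fully invariant submodule
   avoiding it is prime. *)
Section AvoidingSequence.
Variables (x : nat -> M) (x_neq0 : forall n, x n != 0).
Hypothesis xS : forall n, x n.+1 \in mprod (fi_closure (x n)) (fi_closure (x n)).

Let avoids K := fully_invariant K /\ forall n, x n \notin K.

(** By [xS], each term lies in the fully invariant closure of its predecessor. *)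
Lemma avoiding_sequence_mem K n m :
  fully_invariant K -> x n \in K -> (n <= m)%N -> x m \in K.
Proof.
move=> fiK Kxn /subnK <-; elim: (m - n)%N => [//|d IHd]; rewrite addSn.
suff sK : {subset mprod (fi_closure (x (d + n))) (fi_closure (x (d + n))) <= K}.
  exact: sK.
by apply/mprod_subP => f k fx _; apply: fi_closure_sub (fx k).
Qed.

(** Zorn's lemma: the union of a nonempty chain still avoids the sequence, and the empty chain is
    bounded by the zero submodule, which avoids it because no term is zero. *)
Lemma maximal_avoiding : exists P, avoids P /\
  forall K, avoids K -> {subset P <= K} -> {subset K <= P}.
Proof.
pose T := {K : submodClosed M | avoids K}.
have avoids0 : avoids (submod_zero M).
  split=> [f y /submod_zeroP -> | n]; first by rewrite linear0 rpred0.
  by apply/negP => /submod_zeroP /eqP; apply/negP.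
pose le (K L : T) := `[< {subset sval K <= sval L} >].
have [||F Fchain|[P avP] Pmax] := @ZL_preorder T (exist _ _ avoids0) le.
- by move=> K; apply/asboolP.
- by move=> L K N /asboolP KL /asboolP LN; apply/asboolP => y /KL /LN.
- have [[K0 FK0]|noF] := pselect (exists K : T, F K); last first.
    by exists (exist _ _ avoids0) => K FK; case: noF; exists K.
  pose F' K := exists2 K' : T, F K' & K = sval K'.
  have F'K0 : F' (sval K0) by exists K0.
  have F'chain K L : F' K -> F' L -> {subset K <= L} \/ {subset L <= K}.
    move=> [K' FK' ->] [L' FL' ->].
    by have [/asboolP|/asboolP] := Fchain K' L' FK' FL'; [left | right].
  have [U UP] := submod_chain_bigcup F'K0 F'chain.
  have avU : avoids U.
    split=> [f y /UP[K F'K Ky] | n].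
      apply/UP; exists K => //; case: F'K Ky => K' _ ->.
      by case: (svalP K') => fiK' _; apply: fiK'.
    apply/negP => /UP[_ [K' _ ->]]; apply/negP; by case: (svalP K').
  exists (exist _ _ avU) => K FK; apply/asboolP => y Ky /=.
  by apply/UP; exists (sval K) => //; exists K.
- exists P; split=> // K avK PK.
  by have /asboolP := Pmax (exist _ _ avK) (asboolT PK).
Qed.

Lemma prime_avoiding : exists2 P : submodClosed M, prime_submod P & x 0 \notin P.
Proof.
have [P [[fiP xP] Pmax]] := maximal_avoiding.
exists P => //; split=> // K L fiK fiL KLP.
(* By maximality of [P], a fully invariant submodule strictly above [P] contains a term of the
   sequence. *)
have meets N : fully_invariant N -> ~ {subset N <= P} ->
    exists n, x n \in submod_sum P N.
  move=> fiN NP; apply: contrapT => noX; apply: NP.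
  have avPN : avoids (submod_sum P N).
    split=> [|n]; first exact: fully_invariant_sum.
    by apply/negP => xn; apply: noX; exists n.
  move=> y Ny; apply: (Pmax _ avPN); first exact: submod_sumSl.
  exact: submod_sumSr.
have [//|KP] := pselect {subset K <= P}; first by left.
have [//|LP] := pselect {subset L <= P}; first by right.
have [n xn] := meets K fiK KP; have [m xm] := meets L fiL LP.
have fiPK := fully_invariant_sum fiP fiK.
have fiPL := fully_invariant_sum fiP fiL.
(* At the larger index a single term lies in both $P + K$ and $P + L$, so its successor lies in $(P
   + K)_M (P + L) \le P$, a contradiction. *)
have xK := avoiding_sequence_mem fiPK xn (leq_maxl n m).
have xL := avoiding_sequence_mem fiPL xm (leq_maxr n m).
have /negP[] := xP (maxn n m).+1.
have /mprod_subP PKPL := mprod_sum_sub fiP KLP.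
set y := x (maxn n m) in xK xL.
suff sP : {subset mprod (fi_closure y) (fi_closure y) <= P} by apply: sP.
apply/mprod_subP => f k fy ky.
by apply: PKPL => [z|]; [apply: (fi_closure_sub fiPL xL)
                        | apply: (fi_closure_sub fiPK xK)].
Qed.

End AvoidingSequence.

Lemma semiprime_prime_avoiding (x : M) : semiprime_module M -> x != 0 ->
  exists2 P : submodClosed M, prime_submod P & x \notin P.
Proof.
move=> sM x_neq0.
(* The condition on [y] sits under the existential so that [choice] yields a total successor
   function; the default 0 is used only when semiprimeness forces [y] to be 0. *)
have step (y : M) : exists z : M, y != 0 ->
    z != 0 /\ z \in mprod (fi_closure y) (fi_closure y).
  have [z_ex|no_z] := pselect (exists z : M,
      z != 0 /\ z \in mprod (fi_closure y) (fi_closure y)).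
    by have [z zP] := z_ex; exists z.
  exists 0 => /eqP[]; apply: (sM (fi_closure y)).
  - exact: fi_closure_fully_invariant.
  - by move=> z zy; apply/eqP/negPn/negP => z_neq0; apply: no_z; exists z.
  - exact: fi_closure_mem.
have [next nextP] := choice step.
pose xs n := iter n next x.
have xs_neq0 n : xs n != 0 by elim: n => [//|n /nextP[]].
by apply: (@prime_avoiding xs) => // n; have [] := nextP _ (xs_neq0 n).
Qed.

(** Zorn's lemma for reverse inclusion: the intersection of a nonempty chain of primes is prime. *)
Lemma minimal_prime_below Q : prime_submod Q ->
  exists2 P : submodClosed M, minimal_prime P & {subset P <= Q}.
Proof.
move=> primeQ.
pose T := {K : submodClosed M | prime_submod K /\ {subset K <= Q}}.
have QP : prime_submod Q /\ {subset Q <= Q} by split.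
pose mk K (KP : prime_submod K /\ {subset K <= Q}) : T := exist _ K KP.
pose ge (K L : T) := `[< {subset sval L <= sval K} >].
have [||F Fchain|[P [primeP PQ]] Pmin] := @ZL_preorder T (mk _ QP) ge.
- by move=> K; apply/asboolP.
- by move=> L K N /asboolP LK /asboolP NL; apply/asboolP => y /NL /LK.
- have [[K0 FK0]|noF] := pselect (exists K : T, F K); last first.
    by exists (mk _ QP) => K FK; case: noF; exists K.
  pose C := submod_bigcap (fun K => exists2 K' : T, F K' & K = sval K').
  have CP : prime_submod C /\ {subset C <= Q}.
    split; last first.
      move=> y /submod_bigcapP yF; case: (svalP K0) => _; apply.
      by apply: yF; exists K0.
    split=> [|K L fiK fiL KLC].
      apply: fully_invariant_bigcap => _ [K' _ ->].
      by case: (svalP K') => [[]].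
    have [//|KC] := pselect {subset K <= C}; first by left.
    have [//|LC] := pselect {subset L <= C}; first by right.
    have misses (N : submodClosed M) : ~ {subset N <= C} ->
        exists2 A : T, F A & ~ {subset N <= sval A}.
      move=> NC; apply: contrapT => noA; apply: NC => y Ny.
      apply/submod_bigcapP => _ [A FA ->]; apply: contrapT => yA.
      by apply: noA; exists A => // NA; apply/yA/NA.
    have [A FA KA] := misses K KC; have [B FB LB] := misses L LC.
    (* The smaller of [A] and [B] contains neither [K] nor [L], although it is prime and contains
       $K_M L$. *)
    have [D [FD DA DB]] : exists D : T,
        [/\ F D, {subset sval D <= sval A} & {subset sval D <= sval B}].
      have [/asboolP BA|/asboolP AB] := Fchain A B FA FB.
        by exists B; split.
      by exists A; split.
    case: (svalP D) => [[_ primeD] _].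
    have [|KD|LD] := primeD K L fiK fiL.
    + by move=> y /KLC /submod_bigcapP; apply; exists D.
    + by case: KA => y /KD /DA.
    + by case: LB => y /LD /DB.
  exists (mk _ CP) => K FK; apply/asboolP => y /submod_bigcapP; apply.
  by exists K.
- exists P => //; split=> // L primeL LP y; apply/idP/idP; first exact: LP.
  have LQ : prime_submod L /\ {subset L <= Q} by split=> // z /LP /PQ.
  by have /asboolP := Pmin (mk _ LQ) (asboolT LP); apply.
Qed.

Lemma semiprime_minimal_primes_cap0 (x : M) : semiprime_module M ->
  (forall P : submodClosed M, minimal_prime P -> x \in P) -> x = 0.
Proof.
move=> sM xP; apply/eqP/negPn/negP => x_neq0.
have [Q primeQ /negP[]] := semiprime_prime_avoiding sM x_neq0.
by have [P minP PQ] := minimal_prime_below primeQ; apply/PQ/xP.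
Qed.

End FullyInvariant.

(** * Left annihilators, and minimal primes as left annihilators *)

Section Annihilators.
Variables (R : pzRingType) (M : lmodType R).

(** Galois connection between sets of endomorphisms and annihilators; it lets an increasing chain of
    annihilators be given by decreasing sets of endomorphisms. *)
Lemma lannihilator_closure (Y : set {linear M -> M}) :
  lannihilator [set f | forall x, lannihilator Y x -> f x = 0]%classic
  = lannihilator Y.
Proof.
apply/seteqP; split=> x /=; first by move=> xY f Yf; apply: xY => y; apply.
by move=> xY f fY; apply: fY.
Qed.

Lemma lannihilator_submod (Y : set {linear M -> M}) :
  exists K : submodClosed M, forall x, x \in K <-> lannihilator Y x.
Proof.
have S0 : lannihilator Y 0 by move=> f _; apply: linear0.
have SD x y : lannihilator Y x -> lannihilator Y y -> lannihilator Y (x + y).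
  by move=> xY yY f Yf; rewrite linearD xY // yY // addr0.
have SZ a x : lannihilator Y x -> lannihilator Y (a *: x).
  by move=> xY f Yf; rewrite linearZ /= xY // scaler0.
by exists (submod_of S0 SD SZ) => x; apply: submod_ofP.
Qed.

End Annihilators.

Section PrimeAnnihilator.
Variables (R : pzRingType) (M : lmodType R).
Implicit Types K L P Q : submodClosed M.

(** Split off one [A i] at a time: $(A_i)_M C$ lies in both $A_i$ and $C$. The first alternative
    comes from the empty intersection, which is [M], as a prime may be improper. *)
Lemma prime_bigcap_sub (P : submodClosed M) (I : eqType) (s : seq I)
    (A : I -> submodClosed M) :
  prime_submod P -> (forall i, fully_invariant (A i)) ->
  (forall x, (forall i, i \in s -> x \in A i) -> x \in P) ->
  (forall x, x \in P) \/ exists2 i, i \in s & {subset A i <= P}.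
Proof.
move=> [fiP primeP] fiA; elim: s => [|i s IHs] sP.
  by left=> x; apply: sP.
pose C := submod_bigcap (fun K => exists2 j, j \in s & K = A j).
have fiC : fully_invariant C.
  by apply: fully_invariant_bigcap => _ [j _ ->]; apply: fiA.
have [|AP|CP] := primeP (A i) C (fiA i) fiC.
- apply/mprod_subP => f k fC Ak; apply: sP => j; rewrite inE => /orP[/eqP->|js].
    exact: fiA.
  by have /submod_bigcapP := fC k; apply; exists j.
- by right; exists i; rewrite ?mem_head.
- have [|all|[j js AjP]] := IHs.
  + by move=> x xs; apply/CP/submod_bigcapP => _ [j js ->]; apply: xs.
  + by left.
  + by right; exists j; rewrite // inE js orbT.
Qed.

Lemma minimal_prime_annihilator t (P : 'I_t -> submodClosed M) :
  semiprime_module M -> projective_in_sigma M ->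
  (forall Q : submodClosed M, minimal_prime Q <-> exists i, Q =i P i) ->
  forall i, exists Z : set {linear M -> M},
    forall x, x \in P i <-> lannihilator Z x.
Proof.
move=> sM projM minPs i.
have minP j : minimal_prime (P j) by apply/minPs; exists j.
have fiP j : fully_invariant (P j) by have [[]] := minP j.
(* The family may repeat a prime, so indices are compared through their submodules. *)
pose s := [seq j <- enum 'I_t | ~~ `[< P j =i P i >]].
have sP j : j \in s -> ~ P j =i P i.
  by rewrite mem_filter => /andP[/asboolPn].
pose Q := submod_bigcap (fun K => exists2 j, j \in s & K = P j).
pose Z := [set f : {linear M -> M} | forall y, f y \in Q]%classic.
exists Z => x.
split=> [Px f /= fQ | xZ].
  (* [f x] lies in [Q], and in [P i] by full invariance, hence in every minimal prime. *)
  apply: (semiprime_minimal_primes_cap0 projM sM) => N /minPs[j NPj].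
  rewrite NPj; have [js|] := boolP (j \in s).
    by have /submod_bigcapP := fQ x; apply; exists j.
  by rewrite mem_filter mem_enum andbT negbK => /asboolP ->; apply: fiP.
have [primePi minPi] := minP i; have [_ primeP] := primePi.
have fiQ : fully_invariant Q.
  by apply: fully_invariant_bigcap => _ [j _ ->]; apply: fiP.
have [| |xP|QP] := primeP (fi_closure x) Q _ fiQ.
- exact: fi_closure_fully_invariant.
- apply/mprod_subP => f k fQ kx; suff -> : f k = 0 by apply: rpred0.
  have [K KP] := lannihilator_submod Z.
  (* [Z] is stable under composition on the right with any endomorphism, so its annihilator is fully
     invariant and contains the closure of [x]. *)
  have fiK : fully_invariant K.
    move=> h y yK; apply/KP => g gQ.
    exact: ((KP y).1 yK (g \o h) (fun z => gQ (h z))).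
  have xK : x \in K by apply/KP.
  exact: (KP k).1 (fi_closure_sub fiK xK kx) f fQ.
- exact/xP/fi_closure_mem.
(* If [Q] is inside [P i], then [P i] is all of [M] or contains some other [P j], against
   minimality. *)
- have [|all|[j js PjP]] := prime_bigcap_sub (s := s) primePi fiP.
  + move=> y ys; apply/QP/submod_bigcapP => _ [j js ->]; exact: ys.
  + exact: all.
  + by case: (sP j js); apply: minPi => //; have [] := minP j.
Qed.

End PrimeAnnihilator.

(** * Endomorphisms of $M/P$, and the chain condition passing from $M$ to $M/P$ *)

Section QuotientEndomorphisms.
Variables (R : pzRingType) (M : lmodType R) (P : submodClosed M).

Lemma quotmod_pi_eqE (x y : M) :
  (quotmod_pi P x == quotmod_pi P y) = (x - y \in P).
Proof. by rewrite -subr_eq0 -linearB quotmod_pi_eq0. Qed.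

Lemma quotmod_induced (f : {linear M -> M}) :
  (forall x, x \in P -> f x \in P) ->
  exists g : {linear quotmod P -> quotmod P},
    forall x, quotmod_pi P (f x) = g (quotmod_pi P x).
Proof.
move=> fP; pose g (q : quotmod P) := quotmod_pi P (f (repr q)).
have gE x : quotmod_pi P (f x) = g (quotmod_pi P x).
  apply/eqP; rewrite eq_sym quotmod_pi_eqE -linearB fP // -quotmod_pi_eqE.
  by rewrite /quotmod_pi reprK.
have g_linear : linear g.
  move=> a p q.
  have [x <-] := quotmod_pi_surj p; have [y <-] := quotmod_pi_surj q.
  by rewrite -linearP -!gE -!linearP.
pose g_mixin := GRing.isLinear.Build R (quotmod P) (quotmod P) *:%R g g_linear.
by exists (HB.pack_for {linear quotmod P -> quotmod P} g g_mixin).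
Qed.

(* The inverse image of [ker g] along M -> M/P is [f^-1(P)], for f a lift of g,
   and if P = ann Z then [f^-1(P)] = ann (Z f). *)
Lemma acc_lannihilators_quot (Z : set {linear M -> M}) :
  projective_in_sigma M -> (forall x, x \in P <-> lannihilator Z x) ->
  acc_lannihilators M -> acc_lannihilators (quotmod P).
Proof.
move=> projM PZ accM Y Yincr.
pose Y' n := [set h : {linear M -> M} | exists f g z, [/\ Y n g, Z z,
  forall x, quotmod_pi P (f x) = g (quotmod_pi P x)
  & h = z \o f :> (M -> M)]]%classic.
have Y'E n x : lannihilator (Y' n) x <-> lannihilator (Y n) (quotmod_pi P x).
  split=> [xY' g Yg | xY h [f [g [z [Yg Zz fg ->]]]]].
    have [f fg] := projective_lift_quot projM g.
    apply/eqP; rewrite -fg quotmod_pi_eq0; apply/PZ => z Zz.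
    by apply: (xY' (z \o f)); exists f, g, z.
  have /PZ : f x \in P by rewrite -quotmod_pi_eq0 fg xY.
  exact.
have [n x /Y'E xY|m mP] := accM Y'; first exact/Y'E/Yincr.
exists m => n mn; apply/seteqP; split=> q; have [x <-] := quotmod_pi_surj q.
  by move=> /Y'E; rewrite mP // => /Y'E.
by move=> /Y'E; rewrite -(mP _ mn) => /Y'E.
Qed.

End QuotientEndomorphisms.

(** * Chain condition and finite uniform dimension passing from the quotients to $M$ *)

Section SubdirectProduct.
Variables (R : pzRingType) (M : lmodType R).

Lemma acc_lannihilators_subdirect t (P : 'I_t -> submodClosed M) :
  (forall i, fully_invariant (P i)) ->
  (forall x, (forall i, x \in P i) -> x = 0) ->
  (forall i, acc_lannihilators (quotmod (P i))) -> acc_lannihilators M.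
Proof.
move=> fiP P0 accP Y Yincr.
have Yle m n : (m <= n)%N ->
    (lannihilator (Y m) `<=` lannihilator (Y n))%classic.
  move=> /subnK <-; elim: (n - m)%N => [//|d IHd] x /IHd.
  exact: Yincr.
pose Z n := [set f : {linear M -> M} |
  forall x, lannihilator (Y n) x -> f x = 0]%classic.
(* The maps that [Z n] induces on $M/P_i$; they decrease with [n], so their annihilators form an
   ascending chain. *)
pose Zq i n := [set g : {linear quotmod (P i) -> quotmod (P i)} |
  exists2 f, Z n f &
  forall x, quotmod_pi (P i) (f x) = g (quotmod_pi (P i) x)]%classic.
have stab i : exists m, forall n, (m <= n)%N ->
    lannihilator (Zq i n) = lannihilator (Zq i m).
  apply: (accP i) => n q qZ g [f Zf fg]; apply: qZ; exists f => // x xY.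
  exact/Zf/Yincr.
have [ms msP] := choice stab.
exists (\max_i ms i) => n mn; apply/seteqP; split=> x; last exact: Yle.
(* By stability, the map induced by [f] on $M/P_i$ kills the class of [x]; hence [f x] lies in every
   [P i]. *)
move=> xY; rewrite -lannihilator_closure => f Zf; apply: P0 => i.
have fi y : y \in P i -> f y \in P i by exact: fiP.
have msi_n : (ms i <= n)%N by apply: leq_trans mn; apply: leq_bigmax.
have [g fg] := quotmod_induced fi.
have Zqg : Zq i (ms i) g.
  exists f => // y yY.
  by apply: Zf; apply: Yle yY; apply: leq_bigmax.
rewrite -quotmod_pi_eq0 fg.
suff xZ : lannihilator (Zq i (ms i)) (quotmod_pi (P i) x).
  exact/eqP/(xZ _ Zqg).
rewrite -(msP i n msi_n) => g' [h Zh hg'].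
by rewrite -hg' Zh // linear0.
Qed.

(** Independence is defined on initial segments of indices. Here [y k] is the unique term of index
    [k], or an empty sum, which fills the gaps with zeros. *)
Lemma independent_submods_seq (N : nat -> submodClosed M) (I : eqType)
    (b : I -> nat) (s : seq I) (x : I -> M) :
  independent_submods N -> injective b -> uniq s ->
  (forall i, x i \in N (b i)) -> \sum_(i <- s) x i = 0 ->
  forall i, i \in s -> x i = 0.
Proof.
move=> indN b_inj s_uniq xN xs0 i0 i0s.
pose n := (\max_(i <- s) b i).+1.
pose y k : M := \sum_(i <- s | b i == k) x i.
have b_lt i : i \in s -> (b i < n)%N.
  by move=> i_s; rewrite ltnS leq_bigmax_seq.
have yb i : i \in s -> y (b i) = x i.
  move=> i_s; rewrite /y (eq_bigl (pred1 i)); last first.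
    by move=> j; rewrite /= (inj_eq b_inj).
  by rewrite -big_filter filter_pred1_uniq // big_seq1.
have yN (k : 'I_n) : y k \in N k.
  by apply: rpred_sum => i /eqP <-.
have y0 : \sum_(k < n) y k = 0.
  rewrite -[RHS]xs0.
  under eq_bigr => k _ do rewrite /y big_mkcond /=.
  rewrite exchange_big /=; rewrite [LHS]big_seq [RHS]big_seq.
  apply: eq_bigr => i i_s; rewrite -big_mkcond /=.
  by rewrite (big_pred1 (Ordinal (b_lt i i_s))).
by rewrite -yb // (indN n (fun k => y k) yN y0 (Ordinal (b_lt i0 i0s))).
Qed.

(* Split the sequence into infinitely many infinite blocks.  If the sum of some
   block meets A trivially, it embeds in M/A; otherwise the intersections of A
   with the sums of the blocks form the new sequence. *)
Lemma independent_submods_cap (A C : submodClosed M) (N : nat -> submodClosed M) :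
  finite_uniform_dim (quotmod A) ->
  (forall k, exists2 x, x \in N k & x != 0) -> independent_submods N ->
  (forall k, {subset N k <= C}) ->
  exists N' : nat -> submodClosed M,
    [/\ forall k, exists2 x, x \in N' k & x != 0, independent_submods N',
        forall k, {subset N' k <= C} & forall k, {subset N' k <= A}].
Proof.
move=> fudA Nneq0 indN NC.
(* An injection of pairs into [nat]: block [j] uses the indices [b (j, k)]. *)
pose b (p : nat * nat) : nat := pickle p.
have b_inj : injective b := pcan_inj pickleK.
pose block j (y : M) := exists n (x : nat -> M),
  (forall k, x k \in N (b (j, k))) /\ y = \sum_(0 <= k < n) x k.
have block_seq j y n (x : nat -> M) : (forall k, x k \in N (b (j, k))) ->
    y = \sum_(0 <= k < n) x k -> block j y by exists n, x.
have [[j Bj0]|Bneq0] :=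
  pselect (exists j, forall y, block j y -> y \in A -> y = 0).
  case: fudA.
  have xB k x : x \in N (b (j, k)) -> block j x.
    move=> Nx; pose y i := if i == k then x else 0.
    apply: (block_seq j x k.+1 y).
      by move=> i; rewrite /y; case: eqP => [->|_]; rewrite ?rpred0.
    rewrite big_mkord (bigD1 ord_max) //= {1}/y eqxx big1 ?addr0 // => i ik.
    by rewrite /y ifN // -[k]/(val (@ord_max k)).
  (* Block [j] embeds in $M/A$, so its members have nonzero independent images there. *)
  exists (fun k => submod_image (quotmod_pi A) (N (b (j, k)))); split.
    move=> k; have [x Nx x_neq0] := Nneq0 (b (j, k)).
    exists (quotmod_pi A x); first by apply/submod_imageP; exists x.
    rewrite quotmod_pi_eq0; apply: contra x_neq0 => Ax.
    by apply/eqP/Bj0 => //; apply: xB Nx.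
  move=> n q qN q0.
  have /choice[x xq] : forall k : nat, exists x, x \in N (b (j, k)) /\
      forall i : 'I_n, i = k :> nat -> quotmod_pi A x = q i.
    move=> k; have [kn|nk] := ltnP k n; last first.
      exists 0; split=> [|i ik]; first exact: rpred0.
      by move: (ltn_ord i); rewrite ik ltnNge nk.
    have /submod_imageP[x Nx xq] := qN (Ordinal kn).
    by exists x; split=> // i ik; rewrite xq; congr q; apply: val_inj.
  have xN k : x k \in N (b (j, k)) by have [] := xq k.
  have xE (i : 'I_n) : quotmod_pi A (x i) = q i by have [_] := xq i; apply.
  have sx0 : \sum_(k <- index_iota 0 n) x k = 0.
    apply: Bj0; first exact: (block_seq j _ n x).
    rewrite -quotmod_pi_eq0 linear_sum big_mkord.
    by rewrite (eq_bigr q) ?q0 // => i _; apply: xE.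
  move=> i; rewrite -xE.
  rewrite (independent_submods_seq (b := fun k => b (j, k)) indN _ _ xN sx0).
  - exact: linear0.
  - by move=> k l /b_inj[].
  - exact: iota_uniq.
  - by rewrite mem_index_iota /=.
have BS0 j : block j 0.
  by exists 0%N, (fun=> 0); split=> [k|]; rewrite ?rpred0 // big_geq.
(* Padding with zeros makes every sufficiently large length usable, so finitely many sums can share
   one. *)
have BE j y : block j y -> exists n (x : nat -> M),
    (forall k, x k \in N (b (j, k))) /\
    forall m, (n <= m)%N -> y = \sum_(0 <= k < m) x k.
  move=> [n [x [xN ->]]]; pose x' k := if (k < n)%N then x k else 0.
  exists n, x'; split=> [k|m nm].
    by rewrite /x'; case: ifP => _; rewrite ?rpred0.
  rewrite (big_cat_nat _ nm) //= [X in _ + X]big_nat_cond [X in _ + X]big1.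
    by rewrite addr0 !big_nat; apply: eq_bigr => k /= kn; rewrite /x' kn.
  by move=> k /andP[/andP[nk _] _]; rewrite /x' ltnNge nk.
have BSD j x y : block j x -> block j y -> block j (x + y).
  move=> /BE[n [u [uN uE]]] /BE[m [v [vN vE]]].
  exists (maxn n m), (fun k => u k + v k); split=> [k|]; first by rewrite rpredD.
  by rewrite big_split /= -uE ?leq_maxl // -vE // leq_maxr.
have BSZ j a x : block j x -> block j (a *: x).
  move=> [n [u [uN ->]]]; exists n, (fun k => a *: u k).
  by split=> [k|]; [rewrite rpredZ | rewrite scaler_sumr].
pose B j := submod_of (BS0 j) (BSD j) (BSZ j).
have BP j y : y \in B j <-> block j y by exact: submod_ofP.
pose N' j := submod_bigcap (fun K => K = A \/ K = B j).
have N'A j : {subset N' j <= A}.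
  by move=> y /submod_bigcapP; apply; left.
have N'B j y : y \in N' j -> block j y.
  by move=> /submod_bigcapP yN; apply/BP/yN; right.
exists N'; split=> //.
- move=> j; apply: contrapT => N'0; apply: Bneq0; exists j => y By Ay.
  apply: contrapT => /eqP y_neq0; apply: N'0; exists y => //.
  by apply/submod_bigcapP => K [] -> //; apply/BP.
- move=> n y yN' y0.
  have /choice[x xP] : forall j : 'I_n, exists x : nat -> M,
      (forall k, x k \in N (b (nat_of_ord j, k))) /\
      exists m, forall m', (m <= m')%N -> y j = \sum_(0 <= k < m') x k.
    move=> j; have /BE[m [x [xN xE]]] := N'B j _ (yN' j).
    by exists x; split=> //; exists m.
  have /choice[ms msP] : forall j : 'I_n, exists m, forall m', (m <= m')%N ->
      y j = \sum_(0 <= k < m') x j k by move=> j; have [_] := xP j.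
  pose m := \max_j ms j.
  have yE j : y j = \sum_(0 <= k < m) x j k by apply: msP; apply: leq_bigmax.
  (* Flattening the double sum reduces independence of the [N' j] to that of [N]. *)
  pose s := [seq (j, k) | j <- enum 'I_n, k <- index_iota 0 m].
  pose b' (p : 'I_n * nat) := b (nat_of_ord p.1, p.2).
  have b'_inj : injective b'.
    by move=> [j k] [j' k'] /b_inj[/val_inj -> ->].
  have s_uniq : uniq s.
    by rewrite allpairs_uniq ?enum_uniq ?iota_uniq // => -[? ?] [? ?] _ _.
  have xN p : x p.1 p.2 \in N (b' p) by have [] := xP p.1.
  have s0 : \sum_(p <- s) x p.1 p.2 = 0.
    rewrite big_allpairs_dep /= big_enum /= -[RHS]y0.
    by apply: eq_bigr => j _; rewrite yE.
  move=> j; rewrite yE big_nat big1 // => k km.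
  pose x' (p : 'I_n * nat) := x p.1 p.2.
  apply: (independent_submods_seq (x := x') indN b'_inj s_uniq xN s0
            (i := (j, k))).
  by apply: allpairs_f; rewrite ?mem_enum ?mem_index_iota.
- move=> j y /N'B[n [x [xN ->]]]; apply: rpred_sum => k _; exact: NC (xN k).
Qed.

Lemma finite_uniform_dim_subdirect t (P : 'I_t -> submodClosed M) :
  (forall x, (forall i, x \in P i) -> x = 0) ->
  (forall i, finite_uniform_dim (quotmod (P i))) -> finite_uniform_dim M.
Proof.
move=> P0 fudP [N [Nneq0 indN]].
suff [N' [N'neq0 _ N'P]] : exists N' : nat -> submodClosed M,
    [/\ forall k, exists2 x, x \in N' k & x != 0, independent_submods N' &
        forall k i, i \in enum 'I_t -> {subset N' k <= P i}].
  have [x N'x /eqP[]] := N'neq0 0%N.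
  by apply: P0 => i; apply: N'P N'x; rewrite mem_enum.
(* Push the sequence into one [P i] after another; keeping it inside [C] preserves the inclusions
   already obtained. *)
elim: (enum 'I_t) => [|i s [N' [N'neq0 indN' N'P]]]; first by exists N; split.
pose C := submod_bigcap (fun K => exists2 j, j \in s & K = P j).
have N'C k : {subset N' k <= C}.
  by move=> x N'x; apply/submod_bigcapP => _ [j js ->]; apply: N'P N'x.
have [N2 [N2neq0 indN2 N2C N2P]] :=
  independent_submods_cap (fudP i) N'neq0 indN' N'C.
exists N2; split=> // k j; rewrite inE => /orP[/eqP-> //|js] x /N2C.
by move=> /submod_bigcapP; apply; exists j.
Qed.

End SubdirectProduct.

Theorem proposition2p25 (R : pzRingType) (M : lmodType R)
    (t : nat) (P : 'I_t -> submodClosed M) :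
  projective_in_sigma M ->
  semiprime_module M ->
  (forall Q : submodClosed M, minimal_prime Q <-> exists i, Q =i P i) ->
  (forall i, finite_uniform_dim (quotmod (P i))) ->
  (goldie_module M <-> forall i, goldie_module (quotmod (P i))).
Proof.
move=> projM sM minPs fudP; split=> [[accM _] i | goldieP].
  have [Z PZ] := minimal_prime_annihilator sM projM minPs i.
  by split; [apply: acc_lannihilators_quot PZ accM | apply: fudP].
have cap0 x : (forall i, x \in P i) -> x = 0.
  move=> xP; apply: (semiprime_minimal_primes_cap0 projM sM) => Q /minPs[i ->].
  exact: xP.
split; last exact: finite_uniform_dim_subdirect cap0 fudP.
apply: acc_lannihilators_subdirect cap0 _ => i; last by case: (goldieP i).
by have [[]] : minimal_prime (P i) by apply/minPs; exists i.
Qed.
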